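(* Let $(a_n)_{n\ge 0},(b_n)_{n\ge 0},(c_n)_{n\ge 0},(d_n)_{n\ge 0}$ be sequences of non-zero real numbers, and let $(x_n)_{n\ge -2}$, $(y_n)_{n\ge -2}$ be a well-defined real solution, with non-zero initial values $x_{-2},x_{-1},x_0,y_{-2},y_{-1},y_0$, of the system $$x_{n+1}=\frac{x_{n-2}y_{n-1}}{y_n(a_n+b_nx_{n-2}y_{n-1})},\qquad y_{n+1}=\frac{y_{n-2}x_{n-1}}{x_n(c_n+d_ny_{n-2}x_{n-1})},\qquad n\ge 0.$$ For integers $s\ge 0$ put $$E_s=\prod_{k=0}^{s-1}a_{4k}c_{4k+2}+x_{-2}y_{-1}\sum_{l=0}^{s-1}\Big((b_{4l}c_{4l+2}+d_{4l+2})\prod_{k=l+1}^{s-1}a_{4k}c_{4k+2}\Big),$$ $$F_s=\prod_{k=0}^{s-1}a_{4k+3}c_{4k+1}+x_{0}y_{-1}\sum_{l=0}^{s-1}\Big((a_{4l+3}d_{4l+1}+b_{4l+3})\prod_{k=l+1}^{s-1}a_{4k+3}c_{4k+1}\Big),$$ $$G_s=c_0\prod_{k=0}^{s-1}a_{4k+2}c_{4k+4}+\Big(d_0\prod_{k=0}^{s-1}a_{4k+2}c_{4k+4}+\sum_{l=0}^{s-1}(b_{4l+2}c_{4l+4}+d_{4l+4})\prod_{k=l+1}^{s-1}a_{4k+2}c_{4k+4}\Big)x_{-1}y_{-2},$$ $$H_s=a_1\prod_{k=0}^{s-1}a_{4k+5}c_{4k+3}+\Big(b_1\prod_{k=0}^{s-1}a_{4k+5}c_{4k+3}+\sum_{l=0}^{s-1}(a_{4l+5}d_{4l+3}+b_{4l+5})\prod_{k=l+1}^{s-1}a_{4k+5}c_{4k+3}\Big)x_{-1}y_{0},$$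 $$I_s=\prod_{k=0}^{s-1}a_{4k+2}c_{4k}+x_{-1}y_{-2}\sum_{l=0}^{s-1}\Big((a_{4l+2}d_{4l}+b_{4l+2})\prod_{k=l+1}^{s-1}a_{4k+2}c_{4k}\Big),$$ $$J_s=\prod_{k=0}^{s-1}a_{4k+1}c_{4k+3}+x_{-1}y_{0}\sum_{l=0}^{s-1}\Big((b_{4l+1}c_{4l+3}+d_{4l+3})\prod_{k=l+1}^{s-1}a_{4k+1}c_{4k+3}\Big),$$ $$K_s=a_0\prod_{k=0}^{s-1}a_{4k+4}c_{4k+2}+\Big(b_0\prod_{k=0}^{s-1}a_{4k+4}c_{4k+2}+\sum_{l=0}^{s-1}(a_{4l+4}d_{4l+2}+b_{4l+4})\prod_{k=l+1}^{s-1}a_{4k+4}c_{4k+2}\Big)x_{-2}y_{-1},$$ $$L_s=c_1\prod_{k=0}^{s-1}a_{4k+3}c_{4k+5}+\Big(d_1\prod_{k=0}^{s-1}a_{4k+3}c_{4k+5}+\sum_{l=0}^{s-1}(b_{4l+3}c_{4l+5}+d_{4l+5})\prod_{k=l+1}^{s-1}a_{4k+3}c_{4k+5}\Big)x_{0}y_{-1}.$$ Then for every integer $n\ge 0$: $$x_{4n-2}=\frac{x_0^{n}y_0^{n}}{x_{-2}^{n-1}y_{-2}^{n}}\prod_{s=0}^{n-1}\frac{E_sG_s}{F_sH_s},\qquad y_{4n-2}=\frac{x_0^{n}y_0^{n}}{x_{-2}^{n}y_{-2}^{n-1}}\prod_{s=0}^{n-1}\frac{I_sK_s}{J_sL_s},$$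 $$x_{4n-1}=\frac{x_{-1}x_{-2}^{n}y_{-2}^{n}}{x_0^{n}y_0^{n}}\prod_{s=0}^{n-1}\frac{J_sL_s}{K_sI_{s+1}},\qquad y_{4n-1}=\frac{y_{-1}x_{-2}^{n}y_{-2}^{n}}{x_0^{n}y_0^{n}}\prod_{s=0}^{n-1}\frac{F_sH_s}{G_sE_{s+1}},$$ $$x_{4n}=\frac{x_0^{n+1}y_0^{n}}{x_{-2}^{n}y_{-2}^{n}}\prod_{s=0}^{n-1}\frac{G_sE_{s+1}}{H_sF_{s+1}},\qquad y_{4n}=\frac{x_0^{n}y_0^{n+1}}{x_{-2}^{n}y_{-2}^{n}}\prod_{s=0}^{n-1}\frac{K_sI_{s+1}}{L_sJ_{s+1}},$$ $$x_{4n+1}=\frac{x_{-2}^{n+1}y_{-2}^{n}y_{-1}}{x_0^{n}y_0^{n+1}(a_0+b_0x_{-2}y_{-1})}\prod_{s=0}^{n-1}\frac{L_sJ_{s+1}}{I_{s+1}K_{s+1}},\qquad y_{4n+1}=\frac{x_{-2}^{n}y_{-2}^{n+1}x_{-1}}{x_0^{n+1}y_0^{n}(c_0+d_0x_{-1}y_{-2})}\prod_{s=0}^{n-1}\frac{H_sF_{s+1}}{E_{s+1}G_{s+1}}.$$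
   Context: Empty products equal $1$ and empty sums equal $0$. A solution is well-defined if no denominator appearing in the recurrence vanishes for any $n\ge 0$. *)

(* Defs.v *)
From HB Require Import structures.
From mathcomp Require Import all_boot all_order all_algebra.
From mathcomp Require Import reals.

Set Implicit Arguments.
Unset Strict Implicit.
Unset Printing Implicit Defensive.

Import Order.TTheory GRing.Theory Num.Theory.
Local Open Scope ring_scope.

(* The coefficient sequences are indexed by nat.  The sequences (x_n) and (y_n),
   n >= -2, are functions on int whose values below -2 are never used. *)

Definition is_solution (R : realType) (a b c d : nat -> R) (x y : int -> R) :
    Prop :=
  forall n : nat,
    x (n%:Z + 1) = (x (n%:Z - 2) * y (n%:Z - 1))
                   / (y n%:Z * (a n + b n * x (n%:Z - 2) * y (n%:Z - 1)))
    /\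
    y (n%:Z + 1) = (y (n%:Z - 2) * x (n%:Z - 1))
                   / (x n%:Z * (c n + d n * y (n%:Z - 2) * x (n%:Z - 1))).

Definition well_defined (R : realType) (a b c d : nat -> R) (x y : int -> R) :
    Prop :=
  forall n : nat,
    y n%:Z * (a n + b n * x (n%:Z - 2) * y (n%:Z - 1)) != 0 /\
    x n%:Z * (c n + d n * y (n%:Z - 2) * x (n%:Z - 1)) != 0.

Section Factors.

Variables (R : realType) (a b c d : nat -> R) (x y : int -> R).

Definition Efac (s : nat) : R :=
  (\prod_(0 <= k < s) (a (4 * k)%N * c (4 * k + 2)%N)
   + x (-2) * y (-1)
     * \sum_(0 <= l < s)
         ((b (4 * l)%N * c (4 * l + 2)%N + d (4 * l + 2)%N)
          * \prod_(l.+1 <= k < s) (a (4 * k)%N * c (4 * k + 2)%N))).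

Definition Ffac (s : nat) : R :=
  (\prod_(0 <= k < s) (a (4 * k + 3)%N * c (4 * k + 1)%N)
   + x 0 * y (-1)
     * \sum_(0 <= l < s)
         ((a (4 * l + 3)%N * d (4 * l + 1)%N + b (4 * l + 3)%N)
          * \prod_(l.+1 <= k < s) (a (4 * k + 3)%N * c (4 * k + 1)%N))).

Definition Gfac (s : nat) : R :=
  (c 0%N * \prod_(0 <= k < s) (a (4 * k + 2)%N * c (4 * k + 4)%N)
   + (d 0%N * \prod_(0 <= k < s) (a (4 * k + 2)%N * c (4 * k + 4)%N)
      + \sum_(0 <= l < s)
          ((b (4 * l + 2)%N * c (4 * l + 4)%N + d (4 * l + 4)%N)
           * \prod_(l.+1 <= k < s) (a (4 * k + 2)%N * c (4 * k + 4)%N)))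
     * x (-1) * y (-2)).

Definition Hfac (s : nat) : R :=
  (a 1%N * \prod_(0 <= k < s) (a (4 * k + 5)%N * c (4 * k + 3)%N)
   + (b 1%N * \prod_(0 <= k < s) (a (4 * k + 5)%N * c (4 * k + 3)%N)
      + \sum_(0 <= l < s)
          ((a (4 * l + 5)%N * d (4 * l + 3)%N + b (4 * l + 5)%N)
           * \prod_(l.+1 <= k < s) (a (4 * k + 5)%N * c (4 * k + 3)%N)))
     * x (-1) * y 0).

Definition Ifac (s : nat) : R :=
  (\prod_(0 <= k < s) (a (4 * k + 2)%N * c (4 * k)%N)
   + x (-1) * y (-2)
     * \sum_(0 <= l < s)
         ((a (4 * l + 2)%N * d (4 * l)%N + b (4 * l + 2)%N)
          * \prod_(l.+1 <= k < s) (a (4 * k + 2)%N * c (4 * k)%N))).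

Definition Jfac (s : nat) : R :=
  (\prod_(0 <= k < s) (a (4 * k + 1)%N * c (4 * k + 3)%N)
   + x (-1) * y 0
     * \sum_(0 <= l < s)
         ((b (4 * l + 1)%N * c (4 * l + 3)%N + d (4 * l + 3)%N)
          * \prod_(l.+1 <= k < s) (a (4 * k + 1)%N * c (4 * k + 3)%N))).

Definition Kfac (s : nat) : R :=
  (a 0%N * \prod_(0 <= k < s) (a (4 * k + 4)%N * c (4 * k + 2)%N)
   + (b 0%N * \prod_(0 <= k < s) (a (4 * k + 4)%N * c (4 * k + 2)%N)
      + \sum_(0 <= l < s)
          ((a (4 * l + 4)%N * d (4 * l + 2)%N + b (4 * l + 4)%N)
           * \prod_(l.+1 <= k < s) (a (4 * k + 4)%N * c (4 * k + 2)%N)))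
     * x (-2) * y (-1)).

Definition Lfac (s : nat) : R :=
  (c 1%N * \prod_(0 <= k < s) (a (4 * k + 3)%N * c (4 * k + 5)%N)
   + (d 1%N * \prod_(0 <= k < s) (a (4 * k + 3)%N * c (4 * k + 5)%N)
      + \sum_(0 <= l < s)
          ((b (4 * l + 3)%N * c (4 * l + 5)%N + d (4 * l + 5)%N)
           * \prod_(l.+1 <= k < s) (a (4 * k + 3)%N * c (4 * k + 5)%N)))
     * x 0 * y (-1)).

End Factors.

(* Main.v *)
Require Import Defs.
From mathcomp Require Import all_boot all_order all_algebra.
From mathcomp Require Import reals.
From mathcomp Require Import zify ring.

Set Implicit Arguments.
Unset Strict Implicit.
Unset Printing Implicit Defensive.

Import Order.TTheory GRing.Theory Num.Theory.
Local Open Scope ring_scope.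

(** The system decouples in the cross products u_n = x_(n-2) y_(n-1) and
    v_n = y_(n-2) x_(n-1): multiplying its equations by y_n and x_n gives
    v_(n+2) = u_n / (a_n + b_n u_n) and u_(n+2) = v_n / (c_n + d_n v_n), so
    the reciprocals satisfy the affine recurrences
      1 / v_(n+2) = a_n / u_n + b_n,   1 / u_(n+2) = c_n / v_n + d_n
    ([cross_inv2]).  Two steps lead from 1 / u_n to 1 / u_(n+4), still affinely
    ([cross_inv4]), so along each residue class modulo 4 the reciprocals have an
    explicit closed form ([affine_inv_closed]).  The eight factors are exactly
    these closed forms, normalized by the first cross product of their chain:
      E_s = u_0 / u_(4s),    K_s = u_0 / v_(4s+2),
      I_s = v_0 / v_(4s),    G_s = v_0 / u_(4s+2),
      J_s = u_1 / u_(4s+1),  H_s = u_1 / v_(4s+3),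
      F_s = v_1 / v_(4s+1),  L_s = v_1 / u_(4s+3).
    The sequences are recovered from
    x_(n+2) / x_n = v_(n+3) / u_(n+2) and its mirror image.  Over four steps
    ([cross_ratio4]) each ratio is the corresponding quotient of factors times
    r or 1 / r, where r = u_1 v_1 / (u_0 v_0) = x_0 y_0 / (x_(-2) y_(-2)), and
    the stated formulas follow by multiplying these ratios ([geometric_prod]).

    The system is invariant under exchanging (x, a, b) with (y, c, d), which
    exchanges u and v; hence the lemmas on cross products are stated for one of
    the two only.  The sequences are reindexed by nat, X_n = x_(n-2) and
    Y_n = y_(n-2). *)

(** * Affine recurrences and products *)

(** Iterating an affine recurrence for the reciprocals of [w].  The value at 0
    is itself given affinely in [z^-1], which covers both the chains starting
    at [z] (g = 1, h = 0) and those starting one step later. *)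
Lemma affine_inv_closed (K : fieldType) (w p q : nat -> K) (z g h : K) :
  z != 0 -> (w 0%N)^-1 = g / z + h ->
  (forall s, (w s.+1)^-1 = p s / w s + q s) ->
  forall s, z / w s =
    g * \prod_(0 <= k < s) p k
    + (h * \prod_(0 <= k < s) p k
       + \sum_(0 <= l < s) (q l * \prod_(l.+1 <= k < s) p k)) * z.
Proof.
move=> z0 w0 wS; elim=> [|s IHs].
  by rewrite !big_geq // w0; field.
rewrite wS mulrDr mulrCA IHs big_nat_recr //= [in RHS]big_nat_recr //=.
rewrite [\prod_(s.+1 <= k < s.+1) _]big_geq // mulr1.
have -> : \sum_(0 <= l < s) (q l * \prod_(l.+1 <= k < s.+1) p k)
          = (\sum_(0 <= l < s) (q l * \prod_(l.+1 <= k < s) p k)) * p s.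
  rewrite mulr_suml; apply: eq_big_nat => l /andP[_ ls].
  by rewrite big_nat_recr // mulrA.
by ring.
Qed.

Lemma geometric_prod (K : comPzRingType) (f g : nat -> K) (r : K) :
  (forall s, f s.+1 = f s * (r * g s)) ->
  forall n, f n = f 0%N * r ^+ n * \prod_(0 <= s < n) g s.
Proof.
move=> fS; elim=> [|n IHn]; first by rewrite big_geq // expr0 !mulr1.
by rewrite fS IHn big_nat_recr //= exprS; ring.
Qed.

(** * Cross products *)

(** With X_n = x_(n-2) and Y_n = y_(n-2), [cross X Y] is the sequence u and
    [cross Y X] the sequence v. *)
Definition cross (K : fieldType) (X Y : nat -> K) (n : nat) : K :=
  X n * Y n.+1.

Section CrossProducts.

Variables (K : fieldType) (X Y : nat -> K).
Hypothesis X_neq0 : forall n, X n != 0.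
Hypothesis Y_neq0 : forall n, Y n != 0.

Lemma cross_neq0 n : cross X Y n != 0.
Proof. by rewrite mulf_neq0. Qed.

(** The cross products in between cancel, leaving a ratio of terms of [X]. *)
Lemma cross_ratio4 n :
  X n.+4 = X n * (cross Y X n.+1 * cross Y X n.+3)
               / (cross X Y n * cross X Y n.+2).
Proof. by rewrite /cross; field; rewrite !X_neq0 !Y_neq0. Qed.

End CrossProducts.

(** One equation of the system, in the reindexed sequences. *)
Definition half_system (K : fieldType) (a b X Y : nat -> K) : Prop :=
  forall n, a n + b n * X n * Y n.+1 != 0 /\
    X n.+3 = (X n * Y n.+1) / (Y n.+2 * (a n + b n * X n * Y n.+1)).

(** The remaining factor [Y n.+2] of the denominator is what turns [X n.+3] into
    a cross product. *)
Lemma cross_inv2 (K : fieldType) (a b X Y : nat -> K) :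
  (forall n, X n != 0) -> (forall n, Y n != 0) -> half_system a b X Y ->
  forall n, (cross Y X n.+2)^-1 = a n / cross X Y n + b n.
Proof.
move=> X0 Y0 sysX n; have [den0 eqX] := sysX n.
by rewrite /cross eqX; field; rewrite X0 !Y0 den0.
Qed.

Lemma cross_inv4 (K : fieldType) (a b c d X Y : nat -> K) :
  (forall n, X n != 0) -> (forall n, Y n != 0) ->
  half_system a b X Y -> half_system c d Y X ->
  forall n, (cross X Y n.+4)^-1
            = (a n * c n.+2) / cross X Y n + (b n * c n.+2 + d n.+2).
Proof.
move=> X0 Y0 sysX sysY n.
by rewrite (cross_inv2 Y0 X0 sysY) (cross_inv2 X0 Y0 sysX); ring.
Qed.

(** * The factors as ratios of cross products *)

Section Factors.

Variables (R : realType) (a b c d : nat -> R) (x y : int -> R).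

Let X (n : nat) : R := x (n%:Z - 2).
Let Y (n : nat) : R := y (n%:Z - 2).
Let u := cross X Y.
Let v := cross Y X.

Hypothesis X_neq0 : forall n, X n != 0.
Hypothesis Y_neq0 : forall n, Y n != 0.
Hypothesis sysX : half_system a b X Y.
Hypothesis sysY : half_system c d Y X.

Let u_neq0 n : u n != 0. Proof. exact: cross_neq0. Qed.
Let v_neq0 n : v n != 0. Proof. exact: cross_neq0. Qed.

Let inv_v2 n : (v n.+2)^-1 = a n / u n + b n.
Proof. exact: cross_inv2. Qed.
Let inv_u2 n : (u n.+2)^-1 = c n / v n + d n.
Proof. exact: cross_inv2. Qed.
Let inv_u4 n : (u n.+4)^-1 = (a n * c n.+2) / u n + (b n * c n.+2 + d n.+2).
Proof. exact: cross_inv4. Qed.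
Let inv_v4 n : (v n.+4)^-1 = (c n * a n.+2) / v n + (d n * a n.+2 + b n.+2).
Proof. exact: cross_inv4. Qed.

Let addS4 i s : (4 * s.+1 + i = (4 * s + i).+4)%N.
Proof. by lia. Qed.

(** The four chains starting with [z = w 0] have [g = 1] and [h = 0] in
    [affine_inv_closed]. *)
Lemma EfacE s : Efac a b c d x y s = u 0%N / u (4 * s)%N.
Proof.
rewrite (@affine_inv_closed _ (fun s => u (4 * s)%N)
  (fun k => a (4 * k)%N * c (4 * k + 2)%N)
  (fun l => b (4 * l)%N * c (4 * l + 2)%N + d (4 * l + 2)%N)
  _ 1 0) //; last by move=> k; rewrite mulnS inv_u4 addn2.
  by rewrite /Efac /u /cross /X /Y; ring.
by rewrite muln0 addr0 mul1r.
Qed.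

Lemma IfacE s : Ifac a b c d x y s = v 0%N / v (4 * s)%N.
Proof.
rewrite (@affine_inv_closed _ (fun s => v (4 * s)%N)
  (fun k => a (4 * k + 2)%N * c (4 * k)%N)
  (fun l => a (4 * l + 2)%N * d (4 * l)%N + b (4 * l + 2)%N)
  _ 1 0) //; last by move=> k; rewrite mulnS inv_v4 addn2; ring.
  by rewrite /Ifac /v /cross /X /Y; ring.
by rewrite muln0 addr0 mul1r.
Qed.

Lemma FfacE s : Ffac a b c d x y s = v 1%N / v (4 * s + 1)%N.
Proof.
rewrite (@affine_inv_closed _ (fun s => v (4 * s + 1)%N)
  (fun k => a (4 * k + 3)%N * c (4 * k + 1)%N)
  (fun l => a (4 * l + 3)%N * d (4 * l + 1)%N + b (4 * l + 3)%N)
  _ 1 0) //; last by move=> k; rewrite addS4 inv_v4 !addnS; ring.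
  by rewrite /Ffac /v /cross /X /Y; ring.
by rewrite muln0 addr0 mul1r.
Qed.

Lemma JfacE s : Jfac a b c d x y s = u 1%N / u (4 * s + 1)%N.
Proof.
rewrite (@affine_inv_closed _ (fun s => u (4 * s + 1)%N)
  (fun k => a (4 * k + 1)%N * c (4 * k + 3)%N)
  (fun l => b (4 * l + 1)%N * c (4 * l + 3)%N + d (4 * l + 3)%N)
  _ 1 0) //; last by move=> k; rewrite addS4 inv_u4 !addnS.
  by rewrite /Jfac /u /cross /X /Y; ring.
by rewrite muln0 addr0 mul1r.
Qed.

(** The remaining four chains start one step after [z], so that [g] and [h] are
    the coefficients of that first step. *)
Lemma GfacE s : Gfac a b c d x y s = v 0%N / u (4 * s + 2)%N.
Proof.
rewrite (@affine_inv_closed _ (fun s => u (4 * s + 2)%N)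
  (fun k => a (4 * k + 2)%N * c (4 * k + 4)%N)
  (fun l => b (4 * l + 2)%N * c (4 * l + 4)%N + d (4 * l + 4)%N)
  _ (c 0%N) (d 0%N)) //; last by move=> k; rewrite addS4 inv_u4 !addnS.
  by rewrite /Gfac /v /cross /X /Y; ring.
exact: inv_u2.
Qed.

Lemma HfacE s : Hfac a b c d x y s = u 1%N / v (4 * s + 3)%N.
Proof.
rewrite (@affine_inv_closed _ (fun s => v (4 * s + 3)%N)
  (fun k => a (4 * k + 5)%N * c (4 * k + 3)%N)
  (fun l => a (4 * l + 5)%N * d (4 * l + 3)%N + b (4 * l + 5)%N)
  _ (a 1%N) (b 1%N)) //; last by move=> k; rewrite addS4 inv_v4 !addnS; ring.
  by rewrite /Hfac /u /cross /X /Y; ring.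
exact: inv_v2.
Qed.

Lemma KfacE s : Kfac a b c d x y s = u 0%N / v (4 * s + 2)%N.
Proof.
rewrite (@affine_inv_closed _ (fun s => v (4 * s + 2)%N)
  (fun k => a (4 * k + 4)%N * c (4 * k + 2)%N)
  (fun l => a (4 * l + 4)%N * d (4 * l + 2)%N + b (4 * l + 4)%N)
  _ (a 0%N) (b 0%N)) //; last by move=> k; rewrite addS4 inv_v4 !addnS; ring.
  by rewrite /Kfac /u /cross /X /Y; ring.
exact: inv_v2.
Qed.

Lemma LfacE s : Lfac a b c d x y s = v 1%N / u (4 * s + 3)%N.
Proof.
rewrite (@affine_inv_closed _ (fun s => u (4 * s + 3)%N)
  (fun k => a (4 * k + 3)%N * c (4 * k + 5)%N)
  (fun l => b (4 * l + 3)%N * c (4 * l + 5)%N + d (4 * l + 5)%N)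
  _ (c 1%N) (d 1%N)) //; last by move=> k; rewrite addS4 inv_u4 !addnS.
  by rewrite /Lfac /v /cross /X /Y; ring.
exact: inv_u2.
Qed.


(** * The sequences as products of the factors *)

Let E := Efac a b c d x y.
Let F := Ffac a b c d x y.
Let G := Gfac a b c d x y.
Let H := Hfac a b c d x y.
Let I := Ifac a b c d x y.
Let J := Jfac a b c d x y.
Let K := Kfac a b c d x y.
Let L := Lfac a b c d x y.
Let facE := (EfacE, FfacE, GfacE, HfacE, IfacE, JfacE, KfacE, LfacE).

Let r : R := (x 0 * y 0) / (x (-2) * y (-2)).

Let rE : r = (u 1%N * v 1%N) / (u 0%N * v 0%N).
Proof.
have -> : r = (X 2%N * Y 2%N) / (X 0%N * Y 0%N) by [].
by rewrite /u /v /cross; field; rewrite !X_neq0 !Y_neq0.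
Qed.

Let ratioX n : X n.+4 = X n * (v n.+1 * v n.+3) / (u n * u n.+2).
Proof. exact: cross_ratio4. Qed.
Let ratioY n : Y n.+4 = Y n * (u n.+1 * u n.+3) / (v n * v n.+2).
Proof. exact: cross_ratio4. Qed.

(* Normalizes all indices to iterated successors of [4 * n]. *)
Let idx := (mulnS, addSn, addnS, addn0, add0n).

(** In the class of -2 and 0 modulo 4 the two numerators of a four-step ratio
    have odd indices and carry u_1 v_1, whence the factor r; in the classes of
    -1 and 1 the parities are exchanged, whence 1 / r. *)
Lemma x_mod0 n : x (4 * n%:Z - 2) =
  x (-2) * r ^+ n * \prod_(0 <= s < n) ((E s * G s) / (F s * H s)).
Proof.
have -> : 4 * n%:Z - 2 = (4 * n)%N%:Z - 2 by lia.
apply: (@geometric_prod _ (fun s => X (4 * s)%N)) => s.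
rewrite /E /F /G /H !facE !idx ratioX rE; field.
by rewrite !u_neq0 !v_neq0.
Qed.

Lemma y_mod0 n : y (4 * n%:Z - 2) =
  y (-2) * r ^+ n * \prod_(0 <= s < n) ((I s * K s) / (J s * L s)).
Proof.
have -> : 4 * n%:Z - 2 = (4 * n)%N%:Z - 2 by lia.
apply: (@geometric_prod _ (fun s => Y (4 * s)%N)) => s.
rewrite /I /J /K /L !facE !idx ratioY rE; field.
by rewrite !u_neq0 !v_neq0.
Qed.

Lemma x_mod1 n : x (4 * n%:Z - 1) =
  x (-1) * r^-1 ^+ n * \prod_(0 <= s < n) ((J s * L s) / (K s * I s.+1)).
Proof.
have -> : 4 * n%:Z - 1 = (4 * n + 1)%N%:Z - 2 by lia.
apply: (@geometric_prod _ (fun s => X (4 * s + 1)%N)) => s.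
rewrite /I /J /K /L !facE !idx ratioX rE; field.
by rewrite !u_neq0 !v_neq0.
Qed.

Lemma y_mod1 n : y (4 * n%:Z - 1) =
  y (-1) * r^-1 ^+ n * \prod_(0 <= s < n) ((F s * H s) / (G s * E s.+1)).
Proof.
have -> : 4 * n%:Z - 1 = (4 * n + 1)%N%:Z - 2 by lia.
apply: (@geometric_prod _ (fun s => Y (4 * s + 1)%N)) => s.
rewrite /E /F /G /H !facE !idx ratioY rE; field.
by rewrite !u_neq0 !v_neq0.
Qed.

Lemma x_mod2 n : x (4 * n%:Z) =
  x 0 * r ^+ n * \prod_(0 <= s < n) ((G s * E s.+1) / (H s * F s.+1)).
Proof.
have -> : 4 * n%:Z = (4 * n + 2)%N%:Z - 2 by lia.
apply: (@geometric_prod _ (fun s => X (4 * s + 2)%N)) => s.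
rewrite /E /F /G /H !facE !idx ratioX rE; field.
by rewrite !u_neq0 !v_neq0.
Qed.

Lemma y_mod2 n : y (4 * n%:Z) =
  y 0 * r ^+ n * \prod_(0 <= s < n) ((K s * I s.+1) / (L s * J s.+1)).
Proof.
have -> : 4 * n%:Z = (4 * n + 2)%N%:Z - 2 by lia.
apply: (@geometric_prod _ (fun s => Y (4 * s + 2)%N)) => s.
rewrite /I /J /K /L !facE !idx ratioY rE; field.
by rewrite !u_neq0 !v_neq0.
Qed.

Lemma x_mod3 n : x (4 * n%:Z + 1) =
  x 1 * r^-1 ^+ n * \prod_(0 <= s < n) ((L s * J s.+1) / (I s.+1 * K s.+1)).
Proof.
have -> : 4 * n%:Z + 1 = (4 * n + 3)%N%:Z - 2 by lia.
apply: (@geometric_prod _ (fun s => X (4 * s + 3)%N)) => s.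
rewrite /I /J /K /L !facE !idx ratioX rE; field.
by rewrite !u_neq0 !v_neq0.
Qed.

Lemma y_mod3 n : y (4 * n%:Z + 1) =
  y 1 * r^-1 ^+ n * \prod_(0 <= s < n) ((H s * F s.+1) / (E s.+1 * G s.+1)).
Proof.
have -> : 4 * n%:Z + 1 = (4 * n + 3)%N%:Z - 2 by lia.
apply: (@geometric_prod _ (fun s => Y (4 * s + 3)%N)) => s.
rewrite /E /F /G /H !facE !idx ratioY rE; field.
by rewrite !u_neq0 !v_neq0.
Qed.

End Factors.

(** The admissibility of the denominators forces every term with nonnegative
    index to be nonzero. *)
Lemma well_defined_neq0 (R : realType) (a b c d : nat -> R) (x y : int -> R) :
  well_defined a b c d x y ->
  forall n : nat, x n%:Z != 0 /\ y n%:Z != 0.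
Proof.
move=> wd n; have [] := wd n.
by rewrite !mulf_eq0 !negb_or => /andP[-> _] /andP[-> _].
Qed.

Theorem mainTheorem1 (R : realType) (a b c d : nat -> R) (x y : int -> R)
    (ha : forall n : nat, a n != 0) (hb : forall n : nat, b n != 0)
    (hc : forall n : nat, c n != 0) (hd : forall n : nat, d n != 0)
    (hx2 : x (-2) != 0) (hx1 : x (-1) != 0) (hx0 : x 0 != 0)
    (hy2 : y (-2) != 0) (hy1 : y (-1) != 0) (hy0 : y 0 != 0)
    (hsol : is_solution a b c d x y)
    (hwd : well_defined a b c d x y) :
  let E := Efac a b c d x y in
  let F := Ffac a b c d x y in
  let G := Gfac a b c d x y in
  let H := Hfac a b c d x y in
  let I := Ifac a b c d x y in
  let J := Jfac a b c d x y in
  let K := Kfac a b c d x y in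
  let L := Lfac a b c d x y in
  forall n : nat,
    x (4 * n%:Z - 2) =
      (x 0 ^+ n * y 0 ^+ n) / (x (-2) ^ (n%:Z - 1) * y (-2) ^+ n)
      * \prod_(0 <= s < n) ((E s * G s) / (F s * H s))
    /\
    y (4 * n%:Z - 2) =
      (x 0 ^+ n * y 0 ^+ n) / (x (-2) ^+ n * y (-2) ^ (n%:Z - 1))
      * \prod_(0 <= s < n) ((I s * K s) / (J s * L s))
    /\
    x (4 * n%:Z - 1) =
      (x (-1) * x (-2) ^+ n * y (-2) ^+ n) / (x 0 ^+ n * y 0 ^+ n)
      * \prod_(0 <= s < n) ((J s * L s) / (K s * I s.+1))
    /\
    y (4 * n%:Z - 1) =
      (y (-1) * x (-2) ^+ n * y (-2) ^+ n) / (x 0 ^+ n * y 0 ^+ n)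
      * \prod_(0 <= s < n) ((F s * H s) / (G s * E s.+1))
    /\
    x (4 * n%:Z) =
      (x 0 ^+ n.+1 * y 0 ^+ n) / (x (-2) ^+ n * y (-2) ^+ n)
      * \prod_(0 <= s < n) ((G s * E s.+1) / (H s * F s.+1))
    /\
    y (4 * n%:Z) =
      (x 0 ^+ n * y 0 ^+ n.+1) / (x (-2) ^+ n * y (-2) ^+ n)
      * \prod_(0 <= s < n) ((K s * I s.+1) / (L s * J s.+1))
    /\
    x (4 * n%:Z + 1) =
      (x (-2) ^+ n.+1 * y (-2) ^+ n * y (-1))
        / (x 0 ^+ n * y 0 ^+ n.+1 * (a 0%N + b 0%N * x (-2) * y (-1)))
      * \prod_(0 <= s < n) ((L s * J s.+1) / (I s.+1 * K s.+1))
    /\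
    y (4 * n%:Z + 1) =
      (x (-2) ^+ n * y (-2) ^+ n.+1 * x (-1))
        / (x 0 ^+ n.+1 * y 0 ^+ n * (c 0%N + d 0%N * x (-1) * y (-2)))
      * \prod_(0 <= s < n) ((H s * F s.+1) / (E s.+1 * G s.+1)).
Proof.
move=> E F G H I J K L n.
pose X (m : nat) := x (m%:Z - 2); pose Y (m : nat) := y (m%:Z - 2).
have shift2 m : m.+2%:Z - 2 = m%:Z by lia.
have X_neq0 m : X m != 0.
  case: m => [|[|m]]; rewrite /X ?shift2 //.
  by have [] := well_defined_neq0 hwd m.
have Y_neq0 m : Y m != 0.
  case: m => [|[|m]]; rewrite /Y ?shift2 //.
  by have [] := well_defined_neq0 hwd m.
have shift3 m : m.+3%:Z - 2 = m%:Z + 1 by lia.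
have shift1 m : m.+1%:Z - 2 = m%:Z - 1 by lia.
have sysX : half_system a b X Y.
  move=> m; have [eqx _] := hsol m; have [wdx _] := hwd m.
  rewrite /X /Y shift3 shift2 shift1 eqx; split=> //.
  by move: wdx; rewrite mulf_eq0 negb_or => /andP[].
have sysY : half_system c d Y X.
  move=> m; have [_ eqy] := hsol m; have [_ wdy] := hwd m.
  rewrite /X /Y shift3 shift2 shift1 eqy; split=> //.
  by move: wdy; rewrite mulf_eq0 negb_or => /andP[].
have [den_a X3] := sysX 0%N; have [den_c Y3] := sysY 0%N.
have x0n := x_mod0 X_neq0 Y_neq0 sysX sysY n.
have y0n := y_mod0 X_neq0 Y_neq0 sysX sysY n.
have x1n := x_mod1 X_neq0 Y_neq0 sysX sysY n.
have y1n := y_mod1 X_neq0 Y_neq0 sysX sysY n.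
have x2n := x_mod2 X_neq0 Y_neq0 sysX sysY n.
have y2n := y_mod2 X_neq0 Y_neq0 sysX sysY n.
have x3n := x_mod3 X_neq0 Y_neq0 sysX sysY n.
have y3n := y_mod3 X_neq0 Y_neq0 sysX sysY n.
(* For the last residue class the first term is x 1 or y 1, which the system
   expresses by the initial values. *)
have x1E : x 1 = x (-2) * y (-1) / (y 0 * (a 0%N + b 0%N * x (-2) * y (-1))).
  exact: X3.
have y1E : y 1 = y (-2) * x (-1) / (x 0 * (c 0%N + d 0%N * x (-1) * y (-2))).
  by rewrite [d 0%N * _ * _]mulrAC; exact: Y3.
have den_a0 : a 0%N + b 0%N * x (-2) * y (-1) != 0 by exact: den_a.
have den_c0 : c 0%N + d 0%N * x (-1) * y (-2) != 0.
  by rewrite [d 0%N * _ * _]mulrAC; exact: den_c.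
(* The exponent is -1 at n = 0, where the power is an inverse. *)
have predX (z : R) : z != 0 -> z ^ (n%:Z - 1) = z ^+ n / z.
  by move=> z0; rewrite expfzDr // exprN1.
move: (expf_neq0 n hx2) (expf_neq0 n hx0) (expf_neq0 n hy2) (expf_neq0 n hy0).
rewrite x0n y0n x1n y1n x2n y2n x3n y3n x1E y1E !predX //.
rewrite !(exprS _ n) !(exprMn, exprVn).
(* The n-th powers are now independent atoms for field. *)
move: (x (-2) ^+ n) (x 0 ^+ n) (y (-2) ^+ n) (y 0 ^+ n).
move=> px2 px0 py2 py0 px2_neq0 px0_neq0 py2_neq0 py0_neq0.
repeat split; congr (_ * _); field; rewrite ?px2_neq0 ?px0_neq0 ?py2_neq0
  ?py0_neq0 ?hx2 ?hx1 ?hx0 ?hy2 ?hy1 ?hy0 ?den_a0 ?den_c0 //.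
Qed.
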